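(* Let $\delta > 0$. There exists $\ell_0 = \ell_0(\delta)$ such that for all integers $\ell \geqslant \ell_0$, all $k \in \mathbb{N}$ with $k \leqslant \ell^2/\delta$, and all real $\lambda \geqslant 2$, the number of sets $S \subset \mathbb{N}$ with $|S| = \ell$, $\sum_{a \in S} a = k$ and $|S + S| \leqslant \lambda \ell$ is at most $$2^{\delta \ell} \left( \frac{(4\lambda - 3)e}{6} \right)^{\ell}.$$
   Context: $\mathbb{N} = \{1,2,3,\ldots\}$. For $A \subset \mathbb{N}$, $A + A = \{a + b : a, b \in A\}$. *)

(* Defs.v *)
From mathcomp Require Import all_boot.
From Stdlib Require Import Reals.

Set Implicit Arguments.
Unset Strict Implicit.
Unset Printing Implicit Defensive.

(* A finite set S of naturals all of whose elements are <= k is encoded as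
   S : {set 'I_k.+1}.  Any S ⊂ ℕ = {1,2,...} with sum k has all elements in
   [1,k], so this encoding loses nothing. *)

Definition sumset_card (n : nat) (S : {set 'I_n}) : nat :=
  size (undup [seq (nat_of_ord a + nat_of_ord b)%N | a <- enum S, b <- enum S]).

(* S consists of positive integers (ℕ = {1,2,3,...}). *)
Definition pos_set (n : nat) (S : {set 'I_n}) : bool :=
  [forall a in S, 0 < nat_of_ord a].

Definition count_sets (l k : nat) (lam : R) : nat :=
  #|[set S : {set 'I_k.+1} |
      [&& pos_set S, #|S| == l, (\sum_(a in S) nat_of_ord a == k)
        & (if Rle_dec (INR (sumset_card S)) (lam * INR l) then true else false)]]|.

(* Main.v *)
(* Let n = C l with C = C(delta) large. The elements of S above n contribute
   little: since their sum is at most k <= l^2 / delta, a generating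
   function evaluated at exp(-theta / l) shows that there are only 2^{o(l)}
   choices for them.

   For the part S1 of S in [0, n), call z popular in A if z has many
   representations as a sum of two elements of A. As long as A, containing S1,
   has more than lam l + q popular sums, some q of them avoid S1 + S1; for such
   a q-set f, S1 is independent in the graph { x ~ y iff x + y in f } on A, which
   has many edges but maximum degree at most q, so the graph container
   algorithm replaces A by one of few sets that are smaller by a positive
   proportion of n. After boundedly many rounds S1 lies in one of 2^{o(l)} sets B
   with at most lam l + q popular sums, and a Pollard-type inequality gives
   |B| <= lam l / 2 + o(l). Finally the number of subsets of B of size at most l is
   bounded by (lam e / 2)^l if lam >= 3 and by 2^|B| if lam <= 3. *)
Require Import Defs.
From mathcomp Require Import all_boot all_order all_algebra zify Rstruct.
From Stdlib Require Import Reals Lra.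

Set Implicit Arguments.
Unset Strict Implicit.
Unset Printing Implicit Defensive.

Delimit Scope nat_scope with N.
Delimit Scope R_scope with R.
Delimit Scope ring_scope with ring.

(** * Generating-function bound for subsets of bounded weight *)

Section WeightCount.
Import GRing.Theory Num.Theory Order.TTheory.

(** Rankin's trick: the product expands into the sum of [x] to the weight of [S] over all
    [S \subset A], and since [x <= 1] each set of weight at most [k] contributes at least
    [x ^ k]. *)
Lemma weight_count (T : finType) (A : {set T}) (wt : T -> nat) (k : nat) (x : R) :
  (0 < x <= 1)%R ->
  (x ^ k * INR #|[set S : {set T} | (S \subset A) && (\sum_(a in S) wt a <= k)%N]|
     <= \big[Rmult/1]_(a in A) (1 + x ^ wt a))%R.
Proof.
Local Open Scope ring_scope.
move=> [/RltP x0 /RleP x1]; apply/RleP.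
rewrite INRE RpowE.
have -> : \big[Rmult/1%R]_(a in A) (1 + x ^ wt a)%R =
   \prod_(a in A) (x ^+ wt a + 1) :> R.
  by apply: eq_bigr => a _; rewrite RpowE RplusE addrC.
(* The value 0 outside [A] kills, after expansion, every subset not contained in [A]. *)
have -> : \prod_(a in A) (x ^+ wt a + 1) =
   \prod_a ((if a \in A then x ^+ wt a else 0) + 1) :> R.
  by rewrite big_mkcond; apply: eq_bigr => a _; case: ifP => // _; rewrite add0r.
rewrite bigA_distr /= RmultE mulr_natr -sumr_const big_mkcond /=.
apply: ler_sum => S _; rewrite inE; case: ifP => [/andP[SA Sk]|_].
  rewrite [leRHS](_ : _ = x ^+ (\sum_(a in S) wt a)).
    by apply: ler_wiXn2l => //; exact: ltW.
  rewrite -prodrXr [RHS]big_mkcond; apply: eq_bigr => a _.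
  by case: ifP => // aS; rewrite (subsetP SA).
by apply: prodr_ge0 => a _; case: ifP => // _; case: ifP => // _; apply/exprn_ge0/ltW.
Qed.
End WeightCount.

(** * Graph containers *)

Definition indep (T : finType) (e : rel T) (S : {set T}) :=
  [forall x in S, forall y in S, ~~ e x y].

(** Concatenates the families; serves both for the union over all graphs and for composing container
    rounds. *)
Lemma cover_flatten (I X Y : eqType) (s : seq I) (P : I -> X -> Prop)
    (Q : X -> Y -> Prop) (b : R) :
  (forall i, i \in s -> exists c : seq Y, (INR (size c) <= b)%R /\
     forall x, P i x -> exists2 y, y \in c & Q x y) ->
  exists c : seq Y, (INR (size c) <= INR (size s) * b)%R /\
     forall i x, i \in s -> P i x -> exists2 y, y \in c & Q x y.
Proof.
elim: s => [_|i s IH H]; first by exists [::]; split => //=; lra.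
have [j js|c [cb cP]] := IH; first by apply: H; rewrite inE js orbT.
have [|c' [cb' cP']] := H i; first by rewrite inE eqxx.
exists (c' ++ c); split=> [|j x].
  by rewrite size_cat plus_INR [size (i :: s)]/= S_INR; lra.
rewrite inE => /orP[/eqP ->|js] /= Px.
  by have [y yc] := cP' _ Px; exists y => //; rewrite mem_cat yc.
by have [y yc] := cP _ _ js Px; exists y => //; rewrite mem_cat yc orbT.
Qed.

(* Branch on a vertex [x] of degree at least [d]: either [x] is not in [S], or all
   its neighbours are not; the condition on [g] makes [g ^ #|A|] an upper bound for
   the number of leaves of this branching. *)
Lemma graph_containers (T : finType) (e : rel T) (d : nat) (g : R) (A : {set T}) :
  (0 < d) -> (1 <= g)%R -> (g ^ d.-1 + 1 <= g ^ d)%R ->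
  exists c : seq {set T}, (INR (size c) <= g ^ #|A|)%R /\
    forall S : {set T}, S \subset A /\ indep e S ->
      exists2 B, B \in c &
        [/\ S \subset B, B \subset A
          & forall x, x \in B -> #|[set y in B | e x y]| < d].
Proof.
move=> d0 g1 gd.
have [m mA] := ubnP #|A|; elim: m A mA => // m IH A mA.
have [/existsP[x /andP[xA dx]]|/existsPn H] :=
  boolP [exists x, (x \in A) && (d <= #|[set y in A | e x y]|)]; last first.
  exists [:: A]; split=> [|S [SA _]]; first exact: pow_R1_Rle.
  exists A; rewrite ?inE //; split=> // x xA.
  by have := H x; rewrite xA /= -ltnNge.
set N := [set y in A | e x y] in dx.
have NA : N \subset A by apply/subsetP => y; rewrite inE => /andP[].
have c1 : #|A :\ x| < #|A| by rewrite [ltnRHS](cardsD1 x) xA.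
have c2 : #|A :\: N| <= #|A| - d by rewrite cardsD (setIidPr NA) leq_sub2l.
have dA : d <= #|A| by apply: leq_trans dx (subset_leq_card NA).
have [|cN [bN HN]] := IH (A :\ x); first by lia.
have [|cY [bY HY]] := IH (A :\: N); first by lia.
exists (cN ++ cY); split.
  rewrite size_cat plus_INR.
  have E1 : #|A :\ x| = (#|A| - d) + d.-1 by have := cardsD1 x A; rewrite xA; lia.
  have E2 : #|A| = (#|A| - d) + d by lia.
  have M : (g ^ #|A :\: N| <= g ^ (#|A| - d))%R by apply: Rle_pow => //; lia.
  rewrite E2 pow_add; rewrite E1 pow_add in bN.
  have G0 : (0 < g ^ (#|A| - d))%R by apply: pow_lt; lra.
  nra.
move=> S [SA iS]; have [xS|xS] := boolP (x \in S).
  have [|B Bc [SB BA dB]] := HY S.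
    split=> //; apply/subsetP => y yS; rewrite !inE (subsetP SA) // andbT /=.
    by move/forall_inP: iS => /(_ _ xS) /forall_inP /(_ _ yS).
  exists B; rewrite ?mem_cat ?Bc ?orbT //; split=> //.
  by apply: subset_trans BA (subsetDl _ _).
have [|B Bc [SB BA dB]] := HN S; first by rewrite subsetD1 SA xS.
exists B; rewrite ?mem_cat ?Bc //; split=> //.
by apply: subset_trans BA (subsetDl _ _).
Qed.

(** * Representation counts and popular sums *)

Definition reps (N : nat) (X Y : {set 'I_N}) (z : nat) : nat :=
  \sum_(x in X) \sum_(y in Y) (x + y == z).

(** Sums are cut off at [M]; the applications take [M] twice a strict bound on the elements, so none
    is lost. *)
Definition popular (N M w : nat) (A : {set 'I_N}) : {set 'I_M} :=
  [set z : 'I_M | w <= reps A A z].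

Definition sumset (N M : nat) (S : {set 'I_N}) : {set 'I_M} :=
  [set z : 'I_M | [exists x in S, exists y in S, x + y == z :> nat]].

Lemma repsC N (X Y : {set 'I_N}) z : reps X Y z = reps Y X z.
Proof.
rewrite /reps exchange_big; apply: eq_bigr => y _; apply: eq_bigr => x _.
by rewrite addnC.
Qed.

Lemma leq_reps N (X Y : {set 'I_N}) z : reps X Y z <= #|X|.
Proof.
rewrite -sum1_card; apply: leq_sum => x _.
rewrite -big_mkcondr sum1_card /=; apply/card_le1_eqP => y y'.
by move=> /andP[_ /eqP yz] /andP[_ /eqP yz']; apply/val_inj => /=; lia.
Qed.

(** Either summand determines the other, so at most [#|A :\: B|] representations have their first
    summand outside [B], and likewise for the second. *)
Lemma reps_subset N (A B : {set 'I_N}) z : B \subset A ->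
  reps A A z <= reps B B z + 2 * #|A :\: B|.
Proof.
move=> BA; rewrite {1}/reps (big_setID B) /= (setIidPr BA).
have H1 := leq_reps (A :\: B) A z; have H2 := leq_reps (A :\: B) B z.
have -> : \sum_(x in B) \sum_(y in A) (x + y == z) = reps B B z + reps B (A :\: B) z.
  rewrite -big_split /=; apply: eq_bigr => x _.
  by rewrite (big_setID B) /= (setIidPr BA).
rewrite repsC in H2; rewrite -addnA leq_add2l mul2n -addnn.
exact: leq_add H2 H1.
Qed.

(** * Containers for sets with small sumset *)

Lemma bin_leq_exp m q : 'C(m, q) <= expn m q.
Proof.
apply: leq_trans (_ : m ^_ q <= _); first by rewrite -bin_ffact leq_pmulr ?fact_gt0.
rewrite ffact_prod; apply: leq_trans (_ : \prod_(i < q) m <= _); last by rewrite prod_nat_const card_ord.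
by apply: leq_prod => i _; apply: leq_subr.
Qed.

Lemma INR_expn m q : INR (expn m q) = (INR m ^ q)%R.
Proof. by elim: q => // q IH; rewrite expnS mult_INR IH. Qed.

(* The graphs are [x ~ y] iff [x + y \in f], for [f] a [q]-set of popular sums of
   [A]: they have at least [q * w] edges, a container of degree below [d] has at
   most [d * n <= q * w / 2], and deleting a vertex destroys at most [2 * q]. *)
Lemma popular_containers N n M E w d q L (g : R) (A : {set 'I_N}) :
  0 < d -> (1 <= g)%R -> (g ^ d.-1 + 1 <= g ^ d)%R ->
  q = 2 * d * E -> 0 < q -> n <= E * w ->
  #|A| <= n -> L + q <= #|popular M w A| ->
  exists c : seq {set 'I_N}, (INR (size c) <= INR M ^ q * g ^ n)%R /\
    forall S : {set 'I_N}, S \subset A -> #|sumset M S| <= L ->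
      exists2 B, B \in c & [/\ S \subset B, B \subset A & 4 * #|B| + w <= 4 * #|A|].
Proof.
move=> d0 g1 gd qE q0 nE An pop.
pose e (f : {set 'I_M}) : rel 'I_N := fun x y => [exists z in f, z == x + y :> nat].
pose fs := [set f : {set 'I_M} | (f \subset popular M w A) && (#|f| == q)].
have [f|c [cb cP]] := @cover_flatten {set 'I_M} {set 'I_N} {set 'I_N} (enum fs)
    (fun f S => S \subset A /\ indep (e f) S)
    (fun S B => [/\ S \subset B, B \subset A & 4 * #|B| + w <= 4 * #|A|]) (g ^ n)%R.
  rewrite mem_enum inE => /andP[/subsetP fpop /eqP fq].
  have [c [cb cP]] := graph_containers (e f) A d0 g1 gd.
  exists c; split; first by apply: Rle_trans cb _; apply: Rle_pow => //; exact/leP.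
  move=> S /cP [B Bc [SB BA deg]]; exists B => //; split=> //.
  have lo : q * w <= \sum_(z in f) reps A A z.
    rewrite -fq -sum_nat_const; apply: leq_sum => z /fpop; by rewrite inE.
  have mid : \sum_(z in f) reps A A z <= \sum_(z in f) reps B B z + q * (2 * #|A :\: B|).
    rewrite -fq -sum_nat_const -big_split; apply: leq_sum => z _; exact: reps_subset.
  (* For fixed [x] and [y] at most one [z] in [f] equals [x + y], so each [x] in [B] contributes at
     most its degree. *)
  have hi : \sum_(z in f) reps B B z <= #|B| * d.
    rewrite /reps exchange_big -sum_nat_const; apply: leq_sum => x xB.
    rewrite exchange_big /=; apply: leq_trans (ltnW (deg x xB)).
    rewrite -sum1_card [leqRHS](eq_bigl (fun y => (y \in B) && e f x y)); last by move=> y; rewrite inE.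
    rewrite big_mkcondr; apply: leq_sum => y yB; rewrite -big_mkcondr sum1_card /=.
    case: ifP => [_|/existsPn H].
      apply/card_le1_eqP => z z' /andP[_ /eqP z1] /andP[_ /eqP z2].
      by apply/val_inj; rewrite /= -z1.
    rewrite leqn0; apply/eqP/eq_card0 => z; rewrite unfold_in /=.
    by have := H z; rewrite eq_sym => /negbTE.
  have BAn := subset_leq_card BA.
  have cD : #|A :\: B| = #|A| - #|B| by rewrite cardsD (setIidPr BA).
  have h1 := leq_trans lo (leq_trans mid (leq_add hi (leqnn _))).
  have h2 : #|B| <= E * w by exact: leq_trans (leq_trans BAn An) nE.
  have h3 : d * #|B| <= d * (E * w) by rewrite leq_mul2l h2 orbT.
  have h4 : q * w <= q * (4 * #|A :\: B|).
    rewrite {}qE in h1 *; move: h1 h3; move: #|A :\: B| #|B| => x y; nia.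
  move: h4; rewrite leq_pmul2l // cD; move: BAn; move: #|A| #|B| => x y; lia.
exists c; split.
  apply: Rle_trans cb _; apply: Rmult_le_compat_r; first by apply: pow_le; lra.
  rewrite -INR_expn; apply: le_INR; apply/leP; rewrite -cardE; apply: leq_trans (bin_leq_exp M q).
  rewrite -[M in leqRHS](card_ord M) -card_draws; apply: subset_leq_card.
  by apply/subsetP => f; rewrite !inE => /andP[].
move=> S SA SL.
have : 0 < #|[set f : {set 'I_M} | f \subset popular M w A :\: sumset M S & #|f| == q]|.
  rewrite cards_draws bin_gt0.
  have := cardsID (sumset M S) (popular M w A).
  have := subset_leq_card (subsetIr (popular M w A) (sumset M S)); lia.
case/card_gt0P => f; rewrite inE subsetD => /andP[/andP[fp fd] fq].
apply: (cP f); first by rewrite mem_enum inE fp.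
split=> //; apply/forall_inP => x xS; apply/forall_inP => y yS.
apply/existsP => -[z /andP[zf /eqP zE]].
have : z \in sumset M S.
  by rewrite inE; apply/exists_inP; exists x => //; apply/exists_inP; exists y; rewrite // zE.
by move/disjointFr: fd => ->.
Qed.

(** Iterates [popular_containers]: every round lowers [4 * #|A|] by at least [w], so [r] rounds
    suffice, each multiplying the size of the family by at most [INR M ^ q * g ^ n]. *)
Lemma sumset_containers N n M E w d q L r (g : R) (A : {set 'I_N}) :
  0 < M -> 0 < w ->
  0 < d -> (1 <= g)%R -> (g ^ d.-1 + 1 <= g ^ d)%R ->
  q = 2 * d * E -> 0 < q -> n <= E * w ->
  #|A| <= n -> 4 * #|A| <= r * w ->
  exists c : seq {set 'I_N}, (INR (size c) <= (INR M ^ q * g ^ n) ^ r)%R /\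
    forall S : {set 'I_N}, S \subset A -> #|sumset M S| <= L ->
      exists2 B, B \in c & [/\ S \subset B, B \subset A & #|popular M w B| < L + q].
Proof.
move=> M0 w0 d0 g1 gd qE q0 nE.
have K1 : (1 <= INR M ^ q * g ^ n)%R.
  have H1 : (1 <= INR M ^ q)%R.
    by apply: pow_R1_Rle; rewrite -[1%R]/(INR 1); apply: le_INR; apply/leP.
  have H2 : (1 <= g ^ n)%R by apply: pow_R1_Rle.
  nra.
elim: r A => [|r IH] A An Ar; have [pop|pop] := ltnP #|popular M w A| (L + q).
1,3: exists [:: A]; split; [exact: pow_R1_Rle | move=> S SA _; exists A; rewrite ?inE //].
  move: pop; suff -> : #|popular M w A| = 0 by lia.
  apply: eq_card0 => z; rewrite inE.
  have := leq_reps A A z; move: Ar; rewrite mul0n leqn0 muln_eq0 /= => /eqP ->.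
  by rewrite leqn0 => /eqP ->; apply/negbTE; rewrite -ltnNge.
have [c [cb cP]] := popular_containers d0 g1 gd qE q0 nE An pop.
have [B Bc|c' [cb' cP']] := @cover_flatten {set 'I_N} {set 'I_N} {set 'I_N} c
    (fun B S => [/\ B \subset A, 4 * #|B| + w <= 4 * #|A|, S \subset B & #|sumset M S| <= L])
    (fun S B => [/\ S \subset B, B \subset A & #|popular M w B| < L + q])
    ((INR M ^ q * g ^ n) ^ r)%R.
  (* Members of [c] lacking these properties have no [S] to cover, so the empty family serves
     them. *)
  have [/andP[BA Bw]|H] := boolP ((B \subset A) && (4 * #|B| + w <= 4 * #|A|)); last first.
    exists [::]; split; first by apply: pow_le; lra.
    by move=> S [BA Bw]; rewrite BA Bw in H.
  have [||c2 [cb2 cP2]] := IH B.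
  - exact: leq_trans (subset_leq_card BA) An.
  - by move: Bw Ar; rewrite [r.+1 * w]mulSn; move: #|A| #|B| (r * w) => x y z; lia.
  exists c2; split=> // S [_ _ SB SL]; have [B' B'c [SB' B'B pop']] := cP2 S SB SL.
  by exists B' => //; split=> //; apply: subset_trans BA.
exists c'; split.
  apply: Rle_trans cb' _ => /=; apply: Rmult_le_compat_r cb; apply: pow_le; lra.
move=> S SA SL; have [B Bc [SB BA Bw]] := cP S SA SL.
exact: (cP' B).
Qed.

(** * Pollard-type inequality for popular sums *)

Lemma reps_card N (X Y : {set 'I_N}) z :
  reps X Y z = #|[set p in setX X Y | p.1 + p.2 == z :> nat]|.
Proof.
rewrite /reps pair_big_dep /= -sum1_card [RHS](eq_bigl
  (fun p : 'I_N * 'I_N => ((p.1 \in X) && (p.2 \in Y)) && (p.1 + p.2 == z))).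
  by rewrite [RHS]big_mkcondr; apply: eq_bigr => p _; case: eqP.
by move=> p; rewrite !inE.
Qed.

(* Writing A = {a_0 < a_1 < ...}, each value is taken at most [t] times by the
   sums a_i + a_j with |i - j| in a band of width [2t]: two representations of
   the same number have i < i' and j > j', so [j - i] drops by at least 2. *)
Lemma popular_lower N n M w t (A : {set 'I_N}) :
  (forall x, x \in A -> x < n) -> M = 2 * n ->
  2 * t * (#|A| - 2 * t) <= t * #|popular M w A| + M * w.
Proof.
move=> An ME; set m := #|A|.
have [mt|tm] := leqP m (2 * t).
  by rewrite (_ : m - 2 * t = 0) ?muln0 //; apply/eqP; rewrite subn_eq0.
have [->|t0] := posnP t; first by rewrite mul0n.
have [x0 x0A] : exists x0, x0 \in A by apply/card_gt0P; rewrite -/m; lia.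
pose s := sort (relpre val leq) (enum A).
have ss : size s = m by rewrite size_sort -cardE.
have sU : uniq s by rewrite sort_uniq enum_uniq.
have sA i : i < m -> nth x0 s i \in A.
  by move=> im; rewrite -mem_enum -(mem_sort (relpre val leq)) mem_nth ?ss.
have sS : sorted (relpre val leq) s by apply: sort_sorted => x y; exact: leq_total.
have mono i j : i < j -> j < m -> nth x0 s i < nth x0 s j.
  move=> ij jm; have im := ltn_trans ij jm.
  rewrite ltn_neqAle; apply/andP; split.
    by apply/eqP => /val_inj /eqP; rewrite nth_uniq ?ss // ltn_eqF.
  apply: (sorted_leq_nth _ _ _ sS); rewrite ?inE ?ss //; last exact: ltnW.
    by move=> x y z; apply: leq_trans.
  by move=> x; apply: leqnn.
pose a i : nat := nth x0 s i.
(* A pair [(i, j)] encodes the indices [i + t] and [i + j], whose difference [j - t] runs from [-t]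
   to [t - 1]. *)
pose sg (p : 'I_(m - 2 * t) * 'I_(2 * t)) := a (p.1 + t) + a (p.1 + p.2).
have sgM p : sg p < M.
  have := ltn_ord p.1; have := ltn_ord p.2 => h1 h2.
  have := An _ (sA (p.1 + t) _); have := An _ (sA (p.1 + p.2) _).
  rewrite /sg /a ME => H1 H2.
  have {}H1 := H1 ltac:(lia); have {}H2 := H2 ltac:(lia); lia.
have tot : #|{: 'I_(m - 2 * t) * 'I_(2 * t)}| =
    \sum_(z < M) #|[set p | sg p == z]|.
  rewrite -sum1_card (partition_big (fun p => Ordinal (sgM p)) predT) //=.
  apply: eq_bigr => z _; rewrite -sum1_card; apply: eq_bigl => p.
  by rewrite !inE.
have pop_le (z : 'I_M) : #|[set p | sg p == z]| <= t.
  have hP (p : 'I_(m - 2 * t) * 'I_(2 * t)) : p.2 %/ 2 < t.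
    by have := ltn_ord p.2; lia.
  rewrite -[leqRHS]card_ord -(card_in_imset (f := fun p => Ordinal (hP p))); first exact: max_card.
  (* Equal halves mean offsets differing by at most 1, so when [p.1] grows the first index increases
     and the second does not decrease. Thus [p.2 %/ 2], with only [t] values, is injective on each
     fibre of [sg]. *)
  have key p p' : sg p = sg p' -> p.2 %/ 2 = p'.2 %/ 2 -> p.1 < p'.1 -> False.
    move=> e1 e2 lt.
    have := ltn_ord p.2; have := ltn_ord p'.2; have := ltn_ord p.1; have := ltn_ord p'.1.
    move=> b1 b2 b3 b4.
    have H1 := mono (p.1 + t) (p'.1 + t) ltac:(lia) ltac:(lia).
    have H2 := mono (p.1 + p.2) (p'.1 + p'.2).
    have H3 : (p.1 + p.2 < p'.1 + p'.2) \/ (p.1 + p.2 = p'.1 + p'.2) by lia.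
    move: e1; rewrite /sg /a; case: H3 => [h|<-]; last by lia.
    have {}H2 := H2 h ltac:(lia); lia.
  move=> [u v] [u' v']; rewrite !inE => /eqP e1 /eqP e2 /(congr1 val) /= e3.
  have e : sg (u, v) = sg (u', v') by rewrite e1 e2.
  have uu : u = u'.
    apply/val_inj; case: (ltngtP u u') => // lt; exfalso.
      exact: (key (u, v) (u', v')).
    by apply: (key (u', v') (u, v)) => //=; rewrite e3.
  subst u; congr pair; apply/val_inj => /=.
  move: e; rewrite /sg /a /= => /addnI /val_inj /eqP.
  have := ltn_ord v; have := ltn_ord v'; have := ltn_ord u' => b1 b2 b3.
  by rewrite nth_uniq ?ss ?eqn_add2l //; [move/eqP | lia | lia].
have unpop (z : 'I_M) : #|[set p | sg p == z]| <= reps A A z.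
  rewrite reps_card -(card_in_imset (f := fun p : 'I_(m - 2 * t) * 'I_(2 * t) =>
     (nth x0 s (p.1 + t), nth x0 s (p.1 + p.2)))).
    apply/subset_leq_card/subsetP => _ /imsetP[[u v] + ->]; rewrite !inE /= => ->.
    by have := ltn_ord v; have := ltn_ord u => b1 b2; rewrite !sA //; lia.
  move=> [u v] [u' v'] _ _ /= [].
  have := ltn_ord v; have := ltn_ord v'; have := ltn_ord u; have := ltn_ord u' => b1 b2 b3 b4.
  move=> /eqP; rewrite nth_uniq ?ss //; [|lia|lia]; rewrite eqn_add2r => /eqP /val_inj <-.
  move=> /eqP; rewrite nth_uniq ?ss //; [|lia|lia]; rewrite eqn_add2l => /eqP /val_inj <-.
  by [].
rewrite mulnC; move: tot; rewrite card_prod !card_ord => ->.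
rewrite (mulnC t) -sum_nat_const.
rewrite [in leqRHS]big_mkcond.
have -> : M * w = \sum_(z < M) w by rewrite sum_nat_const card_ord.
rewrite -big_split /=; apply: leq_sum => z _.
rewrite inE; case: (leqP w (reps A A z)) => [_|lt]; first exact: leq_trans (pop_le z) (leq_addr _ _).
by rewrite add0n; apply: leq_trans (unpop z) (ltnW lt).
Qed.

(** * Counting small subsets and sets of large elements *)

Lemma small_subsets_count (T : finType) (B : {set T}) (l : nat) (y : R) :
  (0 < y <= 1)%R ->
  (y ^ l * INR #|[set S : {set T} | (S \subset B) && (#|S| <= l)%N]| <= (1 + y) ^ #|B|)%R.
Proof.
move=> y01; have := weight_count B (fun=> 1) l y01.
rewrite big_const pow_1.
have -> : iter #|B| (Rmult (1 + y)) 1%R = ((1 + y) ^ #|B|)%R by elim: #|B| => //= m ->.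
by under eq_finset do rewrite sum1_card.
Qed.

(** [weight_count] with the elements as weights, then [1 + x ^ i <= exp (x ^ i)] and the geometric
    series from [n] on. *)
Lemma tail_count (N n k : nat) (x : R) : (0 < x < 1)%R ->
  (x ^ k * INR #|[set S : {set 'I_N} |
       (S \subset [set i : 'I_N | n <= i]) && (\sum_(i in S) i <= k)]|%N
     <= exp (x ^ n / (1 - x)))%R.
Proof.
move=> x01; have x01' : (0 < x <= 1)%R by lra.
apply: Rle_trans (weight_count [set i : 'I_N | n <= i] (@nat_of_ord N) k x01') _.
rewrite (eq_bigl (fun i : 'I_N => n <= i)); last by move=> i; rewrite inE.
rewrite -(big_mkord (fun i => n <= i) (fun i => 1 + x ^ i)%R).
have x1 : (0 < / (1 - x))%R by apply: Rinv_0_lt_compat; lra.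
have xn m : (0 < x ^ m)%R by apply: pow_lt; lra.
(* The exact partial geometric sum lets the induction on [N] pass; [maxn] makes it zero while
   [N <= n]. *)
suff H : (\big[Rmult/1%R]_(0 <= i < N | (n <= i)%N) (1 + x ^ i) <=
          exp ((x ^ n - x ^ (maxn N n)) / (1 - x)))%R.
  apply: Rle_trans H _; have E : (0 < x ^ maxn N n / (1 - x))%R by apply: Rmult_lt_0_compat.
  by left; apply: exp_increasing; rewrite /Rdiv in E *; nra.
elim: N => [|N IH].
  rewrite big_nil max0n Rminus_diag /Rdiv Rmult_0_l exp_0; lra.
rewrite big_mkcond big_nat_recr // -big_mkcond /=; have [nN|Nn] := leqP n N.
  rewrite (maxn_idPl (leqW nN)); rewrite (maxn_idPl nN) in IH.
  have -> : ((x ^ n - x ^ N.+1) / (1 - x) = (x ^ n - x ^ N) / (1 - x) + x ^ N)%R.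
    by rewrite /=; field; lra.
  rewrite exp_plus; apply: Rmult_le_compat => //; last exact/exp_ineq1_le.
    by apply: big_ind => [|a b ? ?|i _]; [lra | nra | have := xn i; lra].
  by have := xn N; lra.
by move: IH; rewrite Rmult_1_r (maxn_idPr Nn) (maxn_idPr (ltnW Nn)).
Qed.

(** * Splitting sets at a threshold *)

Lemma union_bound (T : finType) (Y : eqType) (c : seq Y) (F : Y -> {set T})
    (U : {set T}) (b : R) :
  (forall S, S \in U -> exists2 B, B \in c & S \in F B) ->
  (forall B, B \in c -> INR #|F B| <= b)%R ->
  (INR #|U| <= INR (size c) * b)%R.
Proof.
elim: c U => [|B c IH] U cov bnd.
  suff -> : U = set0 by rewrite cards0 /=; lra.
  by apply/setP => S; rewrite inE; apply/negP => /cov[].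
rewrite -(cardsID (F B)) plus_INR [size _]/= S_INR.
have h1 : (INR #|U :&: F B| <= b)%R.
  apply: Rle_trans (bnd B _); last by rewrite inE eqxx.
  by apply/le_INR/leP/subset_leq_card/subsetIr.
have h2 : (INR #|U :\: F B| <= INR (size c) * b)%R.
  apply: IH => [S|B' B'c]; last by apply: bnd; rewrite inE B'c orbT.
  rewrite inE => /andP[SB /cov[B']]; rewrite inE => /orP[/eqP -> SB'|]; last by exists B'.
  by rewrite SB' in SB.
lra.
Qed.

Lemma sumset_leq (N M : nat) (S S' : {set 'I_N}) :
  S \subset S' -> #|sumset M S| <= sumset_card S'.
Proof.
move=> /subsetP SS'; rewrite cardE -(size_map val) /sumset_card.
apply: uniq_leq_size; first by rewrite map_inj_uniq ?enum_uniq //; exact: val_inj.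
move=> _ /mapP[z + ->]; rewrite mem_enum inE.
move=> /exists_inP[x xS /exists_inP[y yS /eqP zE]].
rewrite /= -zE mem_undup; apply/allpairsP; exists (x, y).
by rewrite !mem_enum !SS'.
Qed.

Lemma card_below (N n : nat) : #|[set x : 'I_N | x < n]| <= n.
Proof.
rewrite cardE -(size_map val) -[leqRHS](size_iota 0).
apply: uniq_leq_size; first by rewrite map_inj_uniq ?enum_uniq //; exact: val_inj.
by move=> _ /mapP[z + ->]; rewrite mem_enum inE mem_iota.
Qed.

(** Sending [S] to [(S :&: below, S :\: below)] is injective; the first part lies in a container,
    giving [b1 * X], and the second has sum at most [k], giving [b2]. *)
Lemma count_sets_le (l k n L : nat) (lam b1 b2 X : R) (c : seq {set 'I_k.+1}) :
  let below := [set x : 'I_k.+1 | x < n] in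
  (forall s, (INR s <= lam * INR l)%R -> s <= L) ->
  (forall S : {set 'I_k.+1}, S \subset below -> #|sumset (2 * n) S| <= L ->
     exists2 B, B \in c & S \subset B) ->
  (INR (size c) <= b1)%R ->
  (forall B, B \in c -> INR #|[set S : {set 'I_k.+1} | (S \subset B) && (#|S| <= l)%N]| <= X)%R ->
  (INR #|[set S : {set 'I_k.+1} |
       (S \subset [set i : 'I_k.+1 | n <= i]) && (\sum_(i in S) i <= k)]|%N <= b2)%R ->
  (0 <= X)%R ->
  (INR (count_sets l k lam) <= b1 * X * b2)%R.
Proof.
move=> below HL cov cb HX Hb X0; set tails := [set S | _] in Hb.
pose U := [set S : {set 'I_k.+1} | [&& S \subset below, #|S| <= l & #|sumset (2 * n) S| <= L]].
have UX : (INR #|U| <= INR (size c) * X)%R.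
  apply: (@union_bound _ _ c (fun B => [set S : {set 'I_k.+1} | (S \subset B) && (#|S| <= l)])) => //.
  move=> S; rewrite inE => /and3P[Sb Sl SL]; have [B Bc SB] := cov S Sb SL.
  by exists B => //; rewrite inE SB.
have : count_sets l k lam <= #|U| * #|tails|.
  rewrite -cardsX /count_sets.
  rewrite -(card_in_imset (f := fun S => (S :&: below, S :\: below))); last first.
    by move=> S S' _ _ [e1 e2]; rewrite -(setID S below) e1 e2 setID.
  apply/subset_leq_card/subsetP => _ /imsetP[S + ->]; rewrite !inE /= => /and4P[_ /eqP Sl /eqP Sk].
  case: Rle_dec => // /HL SL _; rewrite subsetIr /=; apply/andP; split; last apply/andP; last split.
  - apply/andP; split; first by rewrite -Sl; apply/subset_leq_card/subsetIl.
    by apply: leq_trans SL; apply/sumset_leq/subsetIl.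
  - by apply/subsetP => x; rewrite !inE -leqNgt => /andP[].
  by apply: leq_trans (eq_leq Sk); rewrite [leqRHS](big_setID below) /= leq_addl.
move/leP/le_INR; rewrite mult_INR => H; apply: Rle_trans H _.
by apply: Rmult_le_compat; [exact: pos_INR | exact: pos_INR | nra | ].
Qed.

(** * Numerical estimates *)

Section Estimates.
Local Open Scope R_scope.

Lemma exp_INR_mul (n : nat) (x : R) : exp (INR n * x) = exp x ^ n.
Proof.
elim: n => [|n IH]; first by rewrite Rmult_0_l exp_0.
by rewrite S_INR Rmult_plus_distr_r Rmult_1_l exp_plus IH Rmult_comm.
Qed.

Lemma exp_le (x y : R) : x <= y -> exp x <= exp y.
Proof. by case=> [/exp_increasing|->]; lra. Qed.

Lemma pow_le_exp (x : R) (n : nat) : 0 <= 1 + x -> (1 + x) ^ n <= exp (INR n * x).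
Proof. by move=> x0; rewrite exp_INR_mul; apply: pow_incr; split=> //; exact: exp_ineq1_le. Qed.

Lemma exp_three_quarters : 2 <= exp (3 / 4).
Proof.
have := @pow_le_exp (3 / 32) 8 ltac:(lra).
have -> : INR 8 * (3 / 32) = 3 / 4 by rewrite /=; lra.
by move=> H; apply: Rle_trans H; lra.
Qed.

Lemma ln2_le : ln 2 <= 3 / 4.
Proof.
have [//|H] := Rle_lt_dec (ln 2) (3 / 4).
have := exp_increasing _ _ H; rewrite exp_ln; last by lra.
by have := exp_three_quarters; lra.
Qed.

Lemma exp1_ge : 5 / 2 <= exp 1.
Proof.
have := @pow_le_exp (1 / 8) 8 ltac:(lra).
have -> : INR 8 * (1 / 8) = 1 by rewrite /=; lra.
by move=> H; apply: Rle_trans H; lra.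
Qed.

(** With [lam = 2 + 2 * s] the left side is [2 * exp (s * ln 2)], at most [2 / (1 - 3 / 4 * s)],
    while [exp 1 >= 5 / 2] bounds the right side below by [(5 + 8 * s) * (5 / 12)]. *)
Lemma exp_half_ln2 (lam : R) :
  2 <= lam <= 3 -> exp (lam / 2 * ln 2) <= (4 * lam - 3) * exp 1 / 6.
Proof.
move=> lam23; pose s := lam / 2 - 1.
have -> : lam / 2 * ln 2 = ln 2 + s * ln 2 by rewrite /s; ring.
rewrite exp_plus exp_ln; last by lra.
have l2 := ln2_le; have l20 := ln_lt_2; have e1 := exp1_ge.
have s01 : 0 <= s <= 1 / 2 by rewrite /s; lra.
have u : s * ln 2 <= 3 / 4 * s by nra.
have E0 := exp_pos (s * ln 2).
have E1 : exp (s * ln 2) * (1 - 3 / 4 * s) <= 1.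
  have := exp_ineq1_le (- (s * ln 2)); rewrite exp_Ropp => H.
  have H1 : exp (s * ln 2) * (1 - 3 / 4 * s) <= exp (s * ln 2) * / exp (s * ln 2).
    by apply: Rmult_le_compat_l; lra.
  by rewrite Rinv_r in H1; lra.
have lamE : lam = 2 + 2 * s by rewrite /s; field.
have H : 2 * exp (s * ln 2) <= (5 + 8 * s) * (5 / 12).
  have p : 0 < 1 - 3 / 4 * s by lra.
  apply: (Rmult_le_reg_r (1 - 3 / 4 * s)) => //; nra.
by apply: Rle_trans H _; rewrite lamE; nra.
Qed.

Lemma small_subsets_bound (T : finType) (B : {set T}) (l : nat) (lam eta : R) :
  2 <= lam -> 0 <= eta -> (0 < l)%N ->
  INR #|B| <= (lam / 2 + eta) * INR l ->
  INR #|[set S : {set T} | (S \subset B) && (#|S| <= l)%N]|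
    <= exp (eta * INR l) * ((4 * lam - 3) * exp 1 / 6) ^ l.
Proof.
move=> lam2 eta0 l0 Bl.
have lR : 0 < INR l by apply/lt_0_INR/leP.
have [lam3|lam3] := Rle_lt_dec lam 3.
  have := @small_subsets_count _ B l 1 ltac:(lra); rewrite pow1 Rmult_1_l => H.
  apply: Rle_trans H _.
  apply: (@Rle_trans _ (exp (eta * INR l) * exp (lam / 2 * ln 2) ^ l)); last first.
    apply: Rmult_le_compat_l; first by left; apply: exp_pos.
    by apply: pow_incr; split; [left; apply: exp_pos | apply: exp_half_ln2; lra].
  rewrite -exp_INR_mul -exp_plus.
  have -> : 1 + 1 = exp (ln 2) by rewrite exp_ln; lra.
  rewrite -exp_INR_mul; apply: exp_le.
  have l2 := ln2_le; have l20 := ln_lt_2.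
  have h1 : INR #|B| * ln 2 <= (lam / 2 + eta) * INR l * ln 2 by apply: Rmult_le_compat_r; lra.
  have h2 : eta * INR l * ln 2 <= eta * INR l * 1 by apply: Rmult_le_compat_l; nra.
  lra.
(* For [y = / b] the bound on [#|B|] gives [(1 + / b) ^ #|B| <= exp l], hence a count of at most
   [(b * exp 1) ^ l]. *)
pose b := lam / 2 + eta; have b1 : 1 <= b by rewrite /b; lra.
have y01 : 0 < / b <= 1.
  split; first by apply: Rinv_0_lt_compat; lra.
  by rewrite -Rinv_1; apply: Rinv_le_contravar; lra.
have := @small_subsets_count _ B l (/ b) y01; set X := INR _ => H.
have H1 : (1 + / b) ^ #|B| <= exp (INR l).
  apply: Rle_trans (@pow_le_exp (/ b) #|B| ltac:(lra)) _; apply: exp_le.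
  apply: (Rmult_le_reg_r b); first by lra.
  by rewrite Rmult_assoc Rinv_l /b; lra.
have bl : 0 < b ^ l by apply: pow_lt; lra.
have H2 : X <= b ^ l * exp (INR l).
  rewrite pow_inv in H.
  apply: (@Rle_trans _ (b ^ l * (/ b ^ l * X))).
    by rewrite -Rmult_assoc Rinv_r; lra.
  by apply: Rmult_le_compat_l; lra.
apply: Rle_trans H2 _.
have -> : exp (INR l) = exp 1 ^ l by rewrite -exp_INR_mul Rmult_1_r.
rewrite (Rmult_comm eta) exp_INR_mul -!Rpow_mult_distr.
have e1 := exp_pos 1; apply: pow_incr; split; first by nra.
have ee := exp_ineq1_le eta.
(* [lam / 2 <= (4 * lam - 3) / 6] holds exactly when [lam >= 3]; the factor [exp eta] absorbs the
   summand [eta]. *)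
have : b <= exp eta * ((4 * lam - 3) / 6).
  by apply: (@Rle_trans _ ((1 + eta) * ((4 * lam - 3) / 6))); [rewrite /b; nra | nra].
by move=> h; apply: (@Rle_trans _ (exp eta * ((4 * lam - 3) / 6) * exp 1)); [nra | lra].
Qed.

(** Takes [x = exp (- theta / l)] in [tail_count]: dividing by [x ^ k] costs the term
    [theta / delta], and the geometric tail gives the other one. *)
Lemma tail_bound (N k l C : nat) (delta theta : R) :
  0 < delta -> 0 < theta <= 1 -> (0 < l)%N -> INR k <= INR l ^ 2 / delta ->
  INR #|[set S : {set 'I_N} |
       (S \subset [set i : 'I_N | C * l <= i]) && (\sum_(i in S) i <= k)]|%N
     <= exp ((theta / delta + 2 * exp (- (theta * INR C)) / theta) * INR l).
Proof.
move=> d0 th l0 kl.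
have lR : 1 <= INR l by rewrite -[1]/(INR 1); apply/le_INR/leP.
pose u := theta / INR l; pose x := exp (- u).
have u0 : 0 < u by apply: Rdiv_lt_0_compat; lra.
have xu : x * (1 + u) <= 1.
  rewrite /x exp_Ropp; have := exp_ineq1_le u; have := exp_pos u => e0 e1.
  apply: (Rmult_le_reg_l (exp u)) => //.
  by rewrite -Rmult_assoc Rinv_r; lra.
have x01 : 0 < x < 1 by split; [exact: exp_pos | have := exp_pos (- u); rewrite -/x; nra].
have := @tail_count N (C * l)%N k x x01; set X := INR #|_| => H.
have xk : x ^ k = exp (- (INR k * u)) by rewrite -exp_INR_mul; congr exp; ring.
have xn : x ^ (C * l)%N = exp (- (theta * INR C)).
  by rewrite -exp_INR_mul mult_INR /u; congr exp; field; lra.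
have ku : INR k * u <= theta / delta * INR l.
  have -> : theta / delta * INR l = INR l ^ 2 / delta * u by rewrite /u; field; lra.
  by apply: Rmult_le_compat_r => //; lra.
have u1 : u <= 1.
  by apply: (Rmult_le_reg_r (INR l)); [lra | rewrite /u /Rdiv Rmult_assoc Rinv_l; lra].
have e0 := exp_pos (- (theta * INR C)).
(* [x <= / (1 + u)] and [u <= 1] give [1 - x >= u / 2]. *)
have inv : / (1 - x) <= 2 / u.
  apply: (Rmult_le_reg_l (1 - x)); first by lra.
  rewrite Rinv_r; last by lra.
  apply: (Rmult_le_reg_r u) => //.
  have -> : (1 - x) * (2 / u) * u = (1 - x) * 2 by field; lra.
  by nra.
have xn' : x ^ (C * l)%N / (1 - x) <= 2 * exp (- (theta * INR C)) / theta * INR l.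
  rewrite xn.
  have -> : 2 * exp (- (theta * INR C)) / theta * INR l = exp (- (theta * INR C)) * (2 / u).
    by rewrite /u; field; lra.
  by apply: Rmult_le_compat_l => //; lra.
apply: (@Rle_trans _ (exp (INR k * u) * exp (x ^ (C * l)%N / (1 - x)))).
  apply: (@Rle_trans _ (exp (INR k * u) * (x ^ k * X))); last first.
    by apply: Rmult_le_compat_l => //; left; apply: exp_pos.
  by rewrite xk -Rmult_assoc -exp_plus Rplus_opp_r exp_0; lra.
by rewrite -exp_plus; apply: exp_le; lra.
Qed.

(** For [P > 0] and [c = rho / P], the right side is the [2 * P]-th power of [exp (c * l / 2)], and
    [(c * l / 2) ^ 2 >= 2 * C * l] once [l >= 8 * C / c ^ 2]. *)
Lemma pow_lin_le_exp (P C : nat) (rho : R) : 0 < rho ->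
  exists l0 : nat, forall l : nat, INR l0 <= INR l -> INR (2 * (C * l))%N ^ P <= exp (rho * INR l).
Proof.
move=> rho0; case: P => [|P].
  exists 0%N => l _; rewrite pow_O -exp_0; apply: exp_le.
  by have := pos_INR l; nra.
pose c := rho / INR P.+1.
have P0 : 0 < INR P.+1 by apply: lt_0_INR; apply/leP.
have c0 : 0 < c by apply: Rdiv_lt_0_compat.
have [l0 l0P] := INR_unbounded (8 * INR C / c ^ 2).
exists l0 => l l0l.
have -> : rho * INR l = INR P.+1 * (c * INR l) by rewrite /c; field; lra.
rewrite exp_INR_mul; apply: pow_incr; split; first exact: pos_INR.
have -> : c * INR l = INR 2 * (c * INR l / 2) by rewrite /=; field.
rewrite exp_INR_mul !mult_INR.
have h := exp_ineq1_le (c * INR l / 2); have lR := pos_INR l.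
have h2 : 8 * INR C <= c ^ 2 * INR l.
  have -> : 8 * INR C = c ^ 2 * (8 * INR C / c ^ 2) by field; lra.
  by apply: Rmult_le_compat_l; nra.
have cl : 0 <= c * INR l by nra.
apply: (@Rle_trans _ ((c * INR l / 2) ^ 2)); last by apply: pow_incr; lra.
rewrite /= in h2 *; nra.
Qed.

Lemma floor_ex (x : R) : 0 <= x ->
  exists L : nat, INR L <= x /\ forall s, INR s <= x -> (s <= L)%N.
Proof.
move=> x0; have [n nx] := INR_unbounded x.
elim: n nx => [|n IH] nx; first by rewrite /= in nx; lra.
have [nx'|nx'] := Rle_lt_dec (INR n) x; last exact: IH.
exists n; split=> // s sx; rewrite leqNgt; apply/negP => /leP/le_INR; lra.
Qed.

Lemma divn_INR (l K : nat) : (0 < K)%N ->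
  INR l / INR K <= INR (l %/ K).+1 <= INR l / INR K + 1.
Proof.
move=> K0; have KR : 0 < INR K by apply/lt_0_INR/leP.
have h1 : INR l <= INR ((l %/ K).+1 * K) by apply/le_INR/leP; rewrite ltnW // -ltn_divLR.
have h2 : INR (l %/ K * K) <= INR l by apply/le_INR/leP; exact: leq_trunc_div.
rewrite !mult_INR S_INR in h1 h2 *.
split; apply: (Rmult_le_reg_r (INR K)) => //; rewrite /Rdiv ?Rmult_plus_distr_r Rmult_assoc Rinv_l; lra.
Qed.

End Estimates.

(** * Choice of the container parameters *)

Section Containers.
Local Open Scope R_scope.

(** The gap needed is [sigma * (1 + sigma) ^ d.-1 >= 1]; Bernoulli's inequality gives it once
    [d.-1 * sigma ^ 2 >= 1]. *)
Lemma branching_base (sigma : R) : 0 < sigma ->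
  exists d : nat, (0 < d)%N /\ (1 + sigma) ^ d.-1 + 1 <= (1 + sigma) ^ d.
Proof.
move=> s0; have [m mP] := INR_unbounded (/ sigma ^ 2).
exists m.+1; split=> //=.
have := poly m sigma s0 => H.
have h : 1 <= INR m * sigma ^ 2.
  have s2 : 0 < sigma ^ 2 by apply: pow_lt.
  have -> : 1 = / sigma ^ 2 * sigma ^ 2 by field; lra.
  by apply: Rmult_le_compat_r; lra.
by rewrite /= in h; nra.
Qed.

(** Divides [popular_lower] by [2 * t] for [t] about [l / J]; the threshold [w], about
    [l / (C * J ^ 2)], keeps [C * l * w / t] below [l / J + C * J]. *)
Lemma container_card (N l C J q L : nat) (B : {set 'I_N}) :
  (0 < C)%N -> (0 < J)%N -> (0 < l)%N ->
  (forall x, x \in B -> (x < C * l)%N) ->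
  (#|popular (2 * (C * l)) (l %/ (C * (J * J))).+1 B| < L + q)%N ->
  INR #|B| <= INR L / 2 + 3 * INR l / INR J + INR q / 2 + INR C * INR J + 2.
Proof.
move=> C0 J0 l0 Bn pop.
set w := (l %/ _).+1 in pop *; pose t := (l %/ J).+1.
have CR : 0 < INR C by apply/lt_0_INR/leP.
have JR : 0 < INR J by apply/lt_0_INR/leP.
have lR : 0 < INR l by apply/lt_0_INR/leP.
have tR := divn_INR l J0; rewrite -/t in tR.
have wR : INR w <= INR l / (INR C * (INR J * INR J)) + 1.
  by have := @divn_INR l (C * (J * J)); rewrite !mult_INR !muln_gt0 C0 J0 => /(_ isT) [].
have := @popular_lower N (C * l) (2 * (C * l)) w t B Bn erefl => H.
have {}H : (2 * t * #|B| <= 4 * (t * t) + t * (L + q) + 2 * (C * l) * w)%N.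
  have : (t * #|popular (2 * (C * l)) w B| <= t * (L + q))%N by rewrite leq_mul2l ltnW ?orbT.
  move: H; move: (#|popular _ _ _|) #|B| (2 * (C * l) * w)%N => p b z; nia.
clearbody w t; move/leP/le_INR: H; rewrite !(plus_INR, mult_INR) /= => H.
have -> : 3 * INR l / INR J = 3 * (INR l / INR J) by rewrite /Rdiv; ring.
have t0 : 0 < INR l / INR J by apply: Rdiv_lt_0_compat.
have cw : INR C * INR l * INR w <= INR t * (INR l / INR J + INR C * INR J).
  apply: (@Rle_trans _ (INR l / INR J * (INR l / INR J + INR C * INR J))); last first.
    by apply: Rmult_le_compat_r; nra.
  apply: (@Rle_trans _ (INR C * INR l * (INR l / (INR C * (INR J * INR J)) + 1))).
    by apply: Rmult_le_compat_l; nra.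
  by right; field; lra.
move: H; move: (INR #|B|) (INR l / INR J) t0 tR cw => b y t0 tR cw H.
have H2 : INR t * b <= INR t * (2 * INR t + (INR L + INR q) / 2 + y + INR C * INR J) by nra.
have H3 := Rmult_le_reg_l (INR t) _ _ ltac:(lra) H2.
lra.
Qed.

(** [q] and [r] do not depend on [l], so [(2 * C * l) ^ (q * r)] is polynomial and fits in half of
    the exponent. Choosing [l0] before [L] later makes it independent of [lam]. *)
Lemma container_family (C J : nat) (rho : R) : (0 < C)%N -> (0 < J)%N -> 0 < rho ->
  exists l0 : nat, forall l N L : nat, INR l0 <= INR l ->
    exists c : seq {set 'I_N}, INR (size c) <= exp (rho * INR l) /\
      (forall B, B \in c -> INR #|B| <= INR L / 2 + 4 * INR l / INR J) /\
      forall S : {set 'I_N}, S \subset [set x : 'I_N | (x < C * l)%N] ->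
        (#|sumset (2 * (C * l)) S| <= L)%N -> exists2 B, B \in c & S \subset B.
Proof.
move=> C0 J0 rho0; pose E := (C * (C * (J * J)))%N; pose r := (4 * E)%N.
have E0 : (0 < E)%N by rewrite !muln_gt0 C0 J0.
have CR : 0 < INR C by apply/lt_0_INR/leP.
have JR : 0 < INR J by apply/lt_0_INR/leP.
have rR : 0 < INR r by apply/lt_0_INR/leP; rewrite muln_gt0.
(* Makes [n * r * sigma = rho / 2 * l] for [n = C * l], the other half of the exponent. *)
pose sigma := rho / (2 * INR C * INR r).
have s0 : 0 < sigma by apply: Rdiv_lt_0_compat => //; nra.
have [d [d0 dP]] := branching_base s0.
pose q := (2 * d * E)%N; have q0 : (0 < q)%N by rewrite muln_gt0 E0 andbT muln_gt0 d0.
have [l1 l1P] := @pow_lin_le_exp (q * r) C (rho / 2) ltac:(lra).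
have [l2 l2P] := INR_unbounded (INR J * (INR q / 2 + INR C * INR J + 2)).
exists (l1 + l2 + 1)%N => l N L; rewrite !plus_INR => ll.
have [p1 p2] := (pos_INR l1, pos_INR l2).
have l0 : (0 < l)%N by apply/leP/INR_lt; rewrite /= in ll *; lra.
pose n := (C * l)%N; pose w := (l %/ (C * (J * J))).+1.
pose below := [set x : 'I_N | (x < n)%N].
have nE : (n <= E * w)%N.
  rewrite /n /E -mulnA leq_mul2l mulnC; apply/orP; right.
  by apply/ltnW; rewrite -ltn_divLR ?muln_gt0 ?C0 ?J0.
have bn : (#|below| <= n)%N := card_below N n.
have n0 : (0 < 2 * n)%N by rewrite !muln_gt0 C0.
have bnr : (4 * #|below| <= r * w)%N.
  by rewrite /r -mulnA leq_mul2l; apply: leq_trans bn nE.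
have [c [cb cP]] := @sumset_containers N n (2 * n) E w d q L r (1 + sigma) below
  n0 isT d0 ltac:(lra) dP erefl q0 nE bn bnr.
(* The cardinality bound is demanded of every member, including those covering nothing, hence the
   filter. *)
exists [seq B : {set 'I_N} <- c | (B \subset below) && (#|popular (2 * n) w B| < L + q)%N]; split.
  apply: Rle_trans (_ : INR (size c) <= _); first by apply/le_INR/leP; rewrite size_filter count_size.
  apply: Rle_trans cb _; rewrite Rpow_mult_distr -!pow_mult.
  have -> : rho * INR l = rho / 2 * INR l + INR (n * r)%N * sigma.
    by rewrite (mult_INR n) /n (mult_INR C) /sigma; field; lra.
  rewrite exp_plus; apply: Rmult_le_compat.
  - by apply/pow_le/pos_INR.
  - by apply: pow_le; lra.
  - by apply: l1P; rewrite /= in ll; lra.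
  - by apply: pow_le_exp; lra.
split=> [B|S Sb SL]; last first.
  have [B Bc [SB Bb pop]] := cP S Sb SL.
  by exists B => //; rewrite mem_filter Bc Bb pop.
rewrite mem_filter => /andP[/andP[/subsetP Bb pop] _].
have Bn x : x \in B -> (x < C * l)%N by move/Bb; rewrite inE.
apply: Rle_trans (container_card C0 J0 l0 Bn pop) _.
have : INR q / 2 + INR C * INR J + 2 <= INR l / INR J.
  apply: (Rmult_le_reg_l (INR J)) => //.
  have -> : INR J * (INR l / INR J) = INR l by field; lra.
  by rewrite /= in ll; lra.
have -> : 4 * INR l / INR J = 3 * INR l / INR J + INR l / INR J by field; lra.
lra.
Qed.

End Containers.

(** * Combining containers, subset counts and tails *)

Theorem theorem1p4 (delta : R) :
  (0 < delta)%R ->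
  exists l0 : nat,
    forall (l k : nat), (l0 <= l)%N ->
      (INR k <= INR l ^ 2 / delta)%R ->
      forall lam : R, (2 <= lam)%R ->
        (INR (count_sets l k lam) <=
           Rpower 2 (delta * INR l) * ((4 * lam - 3) * exp 1 / 6) ^ l)%R.
Proof.
(* Containers, subset counts and tails each cost a factor [exp (rho * l)], together
   [exp (delta * l / 2)]; this is affordable as [ln 2 > 1 / 2]. *)
move=> d0; pose rho := (delta / 6)%R; have rho0 : (0 < rho)%R by rewrite /rho; lra.
pose theta := Rmin 1 (rho * delta / 2).
have th : (0 < theta <= 1)%R.
  by split; [apply: Rmin_glb_lt; nra | apply: Rmin_l].
have thd : (theta / delta <= rho / 2)%R.
  have -> : (rho / 2 = rho * delta / 2 / delta)%R by field; lra.
  apply: Rmult_le_compat_r; last exact: Rmin_r.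
  by left; apply: Rinv_0_lt_compat.
(* Since [exp (- (theta * C)) <= / (theta * C)], this size of [C] brings the second tail term down
   to [rho / 2]. *)
have [C' CP'] := INR_unbounded (4 / (theta ^ 2 * rho)).
pose C := C'.+1; have CP : (4 / (theta ^ 2 * rho) < INR C)%R by rewrite S_INR; lra.
have CR : (0 < INR C)%R by apply/lt_0_INR/leP.
have tC : (2 * exp (- (theta * INR C)) / theta <= rho / 2)%R.
  have tC0 : (0 < theta * INR C)%R by nra.
  have h : (exp (- (theta * INR C)) <= / (theta * INR C))%R.
    rewrite exp_Ropp; apply: Rinv_le_contravar => //.
    by have := exp_ineq1_le (theta * INR C); lra.
  apply: (@Rle_trans _ (2 * / (theta * INR C) / theta)).
    apply: Rmult_le_compat_r; first by left; apply: Rinv_0_lt_compat; lra.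
    by lra.
  apply: (Rmult_le_reg_r (2 * INR C / rho)); first by apply: Rdiv_lt_0_compat; lra.
  have -> : (2 * / (theta * INR C) / theta * (2 * INR C / rho) = 4 / (theta ^ 2 * rho))%R.
    by field; lra.
  have -> : (rho / 2 * (2 * INR C / rho) = INR C)%R by field; lra.
  lra.
have [J' JP'] := INR_unbounded (4 / rho).
pose J := J'.+1; have JP : (4 / rho < INR J)%R by rewrite S_INR; lra.
have JR : (0 < INR J)%R by apply/lt_0_INR/leP.
have [l0 l0P] := @container_family C J rho isT isT rho0.
exists l0.+1 => l k ll kl lam lam2.
have l_gt0 : 0 < l by apply: leq_trans ll.
have lR : (0 < INR l)%R by apply/lt_0_INR/leP.
have [L [LP Lmax]] := @floor_ex (lam * INR l) ltac:(nra).
have [c [cb [cB cP]]] := l0P l k.+1 L ltac:(by apply/le_INR/leP/ltnW).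
have lam0 : (0 <= ((4 * lam - 3) * exp 1 / 6) ^ l)%R.
  by apply: pow_le; have := exp_pos 1; nra.
apply: Rle_trans (@count_sets_le l k (C * l) L lam _ _
  (exp (rho * INR l) * ((4 * lam - 3) * exp 1 / 6) ^ l) c Lmax cP cb _
  (@tail_bound k.+1 k l C delta theta d0 th l_gt0 kl) _) _.
- move=> B Bc; apply: small_subsets_bound => //; first by lra.
  apply: Rle_trans (cB B Bc) _.
  have h : (4 / INR J <= rho)%R.
    apply: (Rmult_le_reg_r (INR J / rho)); first by apply: Rdiv_lt_0_compat.
    have -> : (4 / INR J * (INR J / rho) = 4 / rho)%R by field; lra.
    have -> : (rho * (INR J / rho) = INR J)%R by field; lra.
    lra.
  have -> : (4 * INR l / INR J = 4 / INR J * INR l)%R by field; lra.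
  have : (4 / INR J * INR l <= rho * INR l)%R by apply: Rmult_le_compat_r; lra.
  lra.
- by apply: Rmult_le_pos => //; left; apply: exp_pos.
rewrite -Rmult_assoc -exp_plus Rmult_assoc (Rmult_comm (_ ^ _)) -Rmult_assoc -exp_plus.
apply: Rmult_le_compat_r => //; rewrite /Rpower; apply: exp_le.
have l2 := ln_lt_2.
have h1 : ((theta / delta + 2 * exp (- (theta * INR C)) / theta) * INR l <= rho * INR l)%R.
  by apply: Rmult_le_compat_r; lra.
have h2 : (delta * INR l * / 2 <= delta * INR l * ln 2)%R by apply: Rmult_le_compat_l; nra.
have h3 : (rho * INR l = delta * INR l / 6)%R by rewrite /rho; field.
lra.
Qed.
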